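(* Let $p,q$ be natural numbers and let $T=T_v$ with $v=\{(p_n,\ell_n,q_n,m_n):n\in\mathbb N\}\in\mathcal W$. Suppose that for every pair $k,\ell\in\mathbb N$ the set $$\Big\{n\in\mathbb N:\ \frac{q_n+\ell}{q}=\frac{p_n+k}{p}\in\mathbb N\Big\}$$ is infinite. Then $T^p\times T^q$ and $T^{-p}\times T^q$ are conservative and ergodic (with respect to $\mu\times\mu$).
   Context: Rank-one construction (cutting and stacking): let $a_n,b_n,c_n,d_n$ ($n\ge 0$) be sequences of positive integers. Let $G_0$ be the unit interval $[0,1)$, a column of height $H_0=1$ (set $h_0=1$). Given the column $G_n$ of height $H_n$ (a stack of intervals, each level mapped to the one above by translation), form $G_{n+1}$ by cutting $G_n$ into four subcolumns of equal width, placing $a_n,b_n,c_n,d_n$ new intervals (''spacers'') on top of the first, second, third and fourth subcolumns respectively, and stacking the subcolumns from left to right (each subcolumn with its spacers placed on top of the previous one). This defines a Lebesgue-measure-preserving invertible transformation $T$ on a subset of $\mathbb R$ with Lebesgue measure $\mu$. Put $p_n=H_n+a_n$, $\ell_n=H_n+b_n$, $q_n=H_n+c_n$, $m_n=H_n+d_n$ and $h_{n+1}=p_n+\ell_n+q_n+H_n$ (so $H_{n+1}=p_n+\ell_n+q_n+m_n$). Write $T=T_v$ with $v=\{(p_n,\ell_n,q_n,m_n):n\in\mathbb N\}$. $\mathcal W$ is the set of such $v$ satisfying $\lim_{n\to\infty}p_n/h_n=\infty$, $\ell_n>n(p_n+q_n+2h_n)$ and $m_n>n(p_n+q_n+H_n+\ell_n)=n\,h_{n+1}$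 for all $n$. A measure-preserving $S$ is conservative if for every set $A$ of positive measure there is $n\ge1$ with $\mu(S^{-n}A\cap A)>0$. *)

(* Defs.v *)
From HB Require Import structures.
From mathcomp Require Import all_boot all_order all_algebra.
From mathcomp Require Import all_classical all_reals all_analysis.

Set Implicit Arguments.
Unset Strict Implicit.
Unset Printing Implicit Defensive.

Import Order.TTheory GRing.Theory Num.Theory.
Local Open Scope classical_set_scope.
Local Open Scope ring_scope.

(* Rank-one cutting and stacking with four subcolumns.
   The spacer sequences a_n, b_n, c_n, d_n are the primary data. *)
Section RankOne.
Variable R : realType.
Variables a b c d : nat -> nat.

Fixpoint Hgt (n : nat) : nat :=
  match n with
  | 0 => 1
  | n'.+1 => ((Hgt n' + a n') + (Hgt n' + b n') + (Hgt n' + c n') + (Hgt n' + d n'))%N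
  end.

Definition pp n := (Hgt n + a n)%N.
Definition ll n := (Hgt n + b n)%N.
Definition qq n := (Hgt n + c n)%N.
Definition mm n := (Hgt n + d n)%N.
Definition hh n := match n with 0 => 1%N | n'.+1 => (pp n' + ll n' + qq n' + Hgt n')%N end.

Definition width (n : nat) : R := (4%:R ^+ n)^-1.

(* left end of the (fresh) region where spacers of stage n are placed *)
Fixpoint spstart (n : nat) : R :=
  match n with
  | 0 => 1
  | n'.+1 => spstart n' + (a n' + b n' + c n' + d n')%N%:R * width n'.+1
  end.

Definition spacers (s : R) (k : nat) (w : R) : seq R :=
  [seq s + i%:R * w | i <- iota 0 k].

(* col n = list of left endpoints of the levels of G_n, bottom to top;
   each level of G_n is the interval [L, L + width n). *)
Fixpoint col (n : nat) : seq R :=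
  match n with
  | 0 => [:: 0]
  | n'.+1 =>
    let w := width n'.+1 in
    let s := spstart n' in
    let C := col n' in
    C ++ spacers s (a n') w
      ++ [seq x + w | x <- C] ++ spacers (s + (a n')%:R * w) (b n') w
      ++ [seq x + 2%:R * w | x <- C] ++ spacers (s + (a n' + b n')%N%:R * w) (c n') w
      ++ [seq x + 3%:R * w | x <- C]
      ++ spacers (s + (a n' + b n' + c n')%N%:R * w) (d n') w
  end.

Definition lev (n j : nat) : R := nth 0 (col n) j.

Definition level (n j : nat) : set R :=
  [set x | lev n j <= x /\ x < lev n j + width n].

Definition rk_space : set R :=
  [set x | exists n j, (j < size (col n))%N /\ level n j x].

Definition up_at (x : R) (nj : nat * nat) : Prop :=
  (nj.2.+1 < size (col nj.1))%N /\ level nj.1 nj.2 x.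

Definition down_at (x : R) (nj : nat * nat) : Prop :=
  (0 < nj.2)%N /\ (nj.2 < size (col nj.1))%N /\ level nj.1 nj.2 x.

(* T maps each non-top level to the one above it by translation
   (identity on the remaining null set and outside X). *)
Definition T (x : R) : R :=
  match pselect (exists nj, up_at x nj) with
  | left e => let nj := projT1 (cid e) in
              x - lev nj.1 nj.2 + lev nj.1 nj.2.+1
  | right _ => x
  end.

Definition Tinv (x : R) : R :=
  match pselect (exists nj, down_at x nj) with
  | left e => let nj := projT1 (cid e) in
              x - lev nj.1 nj.2 + lev nj.1 nj.2.-1
  | right _ => x
  end.

Definition inW : Prop :=
  [/\ (fun n => (pp n)%:R / (hh n)%:R : R) @ \oo --> +oo,
      (forall n, (n * (pp n + qq n + 2 * hh n) < ll n)%N) &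
      (forall n, (n * (pp n + qq n + Hgt n + ll n) < mm n)%N)].

End RankOne.

Definition conservative d (U : measurableType d) (R : realType)
  (mu : set U -> \bar R) (D : set U) (S : U -> U) : Prop :=
  forall A, measurable A -> A `<=` D -> (0 < mu A)%E ->
    exists n, (0 < n)%N /\ (0 < mu ((iter n S) @^-1` A `&` A))%E.

Definition ergodic d (U : measurableType d) (R : realType)
  (mu : set U -> \bar R) (D : set U) (S : U -> U) : Prop :=
  forall A, measurable A -> A `<=` D -> D `&` S @^-1` A = A ->
    mu A = 0%E \/ mu (D `\` A) = 0%E.

(* Main.v *)
(* All levels of the column G_n are cells of the grid of mesh w_n = 4^-n, so a
   set of positive measure in X x X fills almost all of some square of levels,
   and does so at every fine enough stage.  Given A and B of positive measure,
   pass to the bottom and top copies of G_N in G_{N+1} to get a square almost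
   filled by A and one almost filled by B, the second lying k levels above the
   first in one coordinate and l levels above in the other (below, in the first
   coordinate, for T^{-p} x T^q).  Averaging over subsquares keeps such a pair,
   with the same k and l, at every later stage.  At a stage n where
   p_n + k = t p and q_n + l = t q, the map T^{tp} carries the first copy of a
   level of G_n to the second copy of the level k above it, and T^{tq} carries
   the third copy to the fourth copy of the level l above; hence some t > 0
   makes (T^p x T^q)^t A meet B in positive measure.  Conservativity (B = A) and
   ergodicity (B = the complement of A) both follow. *)
Require Import Defs.
From HB Require Import structures.
From mathcomp Require Import all_boot all_order all_algebra.
From mathcomp Require Import all_classical all_reals all_analysis.
From mathcomp Require Import measurable_realfun ring lra zify.

Set Implicit Arguments.
Unset Strict Implicit.
Unset Printing Implicit Defensive.

Import Order.TTheory GRing.Theory Num.Theory.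
Local Open Scope classical_set_scope.
Local Open Scope ring_scope.

(** * Approximation of measurable sets by an algebra, for a finite measure *)

Section Approximation.
Context d (U : measurableType d) (R : realType).
Variables (m : {measure set U -> \bar R}) (G : set (set U)).
Hypothesis m_fin : (m setT < +oo)%E.
Hypothesis G_measurable : G `<=` measurable.
Hypothesis G0 : G set0.
Hypothesis GC : forall F, G F -> G (~` F).
Hypothesis GU : forall E F, G E -> G F -> G (E `|` F).

Definition approximable (E : set U) := measurable E /\
  forall e : R, 0 < e -> exists2 F, G F & (m (E `+` F) < e%:E)%E.

Lemma measurableY (E F : set U) :
  measurable E -> measurable F -> measurable (E `+` F).
Proof. by move=> mE mF; apply: measurableU; exact: measurableD. Qed.

Lemma approximable_alg : G `<=` approximable.
Proof.
move=> F GF; split; first exact: G_measurable.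
by move=> e e0; exists F => //; rewrite setYK measure0 lte_fin.
Qed.

Lemma approximableC E : approximable E -> approximable (~` E).
Proof.
move=> [mE aE]; split; first exact: measurableC.
move=> e /aE[F GF mF]; exists (~` F); first exact: GC.
by rewrite /setY !setDE !setCK setUC (setIC (~` E)) (setIC (~` F)).
Qed.

Lemma approximableU E E' :
  approximable E -> approximable E' -> approximable (E `|` E').
Proof.
move=> [mE aE] [mE' aE']; split; first exact: measurableU.
move=> e e0; have e20 : 0 < e / 2 by lra.
have [F GF mF] := aE _ e20; have [F' GF' mF'] := aE' _ e20.
exists (F `|` F'); first exact: GU.
have mY : measurable (E `+` F) by apply: measurableY => //; exact: G_measurable.
have mY' : measurable (E' `+` F') by apply: measurableY => //; exact: G_measurable.
apply: (@le_lt_trans _ _ (m ((E `+` F) `|` (E' `+` F')))).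
  apply: le_measure; rewrite ?inE.
  - by apply: measurableY; apply: measurableU => //; exact: G_measurable.
  - exact: measurableU.
  - by move=> x; rewrite /setY/=; tauto.
apply: (@le_lt_trans _ _ (m (E `+` F) + m (E' `+` F'))%E).
  exact: measureU2.
by rewrite [e]splitr EFinD lteD.
Qed.

(** The partial unions exhaust the union, and continuity from above, available because [m] is
    finite, makes the remainder small. Half of [e] pays for the remainder, half for approximating
    one partial union. *)
Lemma approximable_bigcup (E : (set U)^nat) :
  (forall n, approximable (E n)) -> approximable (\bigcup_n E n).
Proof.
move=> aE; have mE : measurable (\bigcup_n E n).
  by apply: bigcupT_measurable => n; have [] := aE n.
split=> // e e0; have e20 : 0 < e / 2 by lra.
pose V n := \big[setU/set0]_(i < n) E i.
have aV n : approximable (V n).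
  rewrite /V; elim: n => [|n IH].
    by rewrite big_ord0; exact: approximable_alg.
  by rewrite big_ord_recr/=; exact: approximableU.
have mV n : measurable (V n) by have [] := aV n.
have : m (\bigcup_n E n `\` V n) @[n --> \oo] --> m (\bigcap_n (\bigcup_n E n `\` V n)).
  apply: nonincreasing_cvg_mu.
  - apply: le_lt_trans m_fin.
    by apply: le_measure; rewrite ?inE//; exact: measurableD.
  - by move=> n; exact: measurableD.
  - by apply: bigcapT_measurable => n; exact: measurableD.
  - move=> i j ij; apply/subsetPset; apply: setDS.
    rewrite /V -!bigcup_mkord => x [k /= ki Ekx]; exists k => //=.
    exact: leq_trans ki ij.
rewrite (_ : \bigcap_n _ = set0); last first.
  rewrite -subset0 => x /= h; have [n _ Enx] := (h 0%N I).1.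
  have [_] := h n.+1 I; apply.
  by rewrite /V -bigcup_mkord; exists n => /=.
rewrite measure0 => /fine_cvgP[_ /cvgrPdist_lt /(_ _ e20)].
move=> [N _ /(_ N (leqnn N))/=]; rewrite sub0r normrN => hN.
have [_ /(_ _ e20)[F GF mF]] := aV N; exists F => //.
have mDV : measurable (\bigcup_n E n `\` V N) by exact: measurableD.
have mVF : measurable (V N `+` F) by apply: measurableY => //; exact: G_measurable.
apply: (@le_lt_trans _ _ (m ((\bigcup_n E n `\` V N) `|` (V N `+` F)))).
  apply: le_measure; rewrite ?inE.
  - by apply: measurableY => //; exact: G_measurable.
  - exact: measurableU.
  - have VE : V N `<=` \bigcup_n E n.
      by rewrite /V -bigcup_mkord => x [i _ Eix]; exists i.
    move=> x; rewrite /setY/=; have := VE x.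
    by have [Vx|nVx] := pselect (V N x); tauto.
apply: (@le_lt_trans _ _ (m (\bigcup_n E n `\` V N) + m (V N `+` F))%E).
  exact: measureU2.
rewrite [e]splitr EFinD lteD// -[m _]fineK ?lte_fin; last first.
  rewrite ge0_fin_numE//; apply: le_lt_trans m_fin.
  by apply: le_measure; rewrite ?inE.
exact: le_lt_trans (ler_norm _) hN.
Qed.

Lemma approximable_sigma_algebra : <<s G >> `<=` approximable.
Proof.
apply: smallest_sub; last exact: approximable_alg.
split; first exact: approximable_alg.
- by move=> A aA; rewrite setTD; exact: approximableC.
- exact: approximable_bigcup.
Qed.

End Approximation.

(** * Measures compared fibre by fibre over a countable type *)

Section Fibers.
Context d (U : measurableType d) (C : countType) (g : U -> C).
Hypothesis mg : forall k, measurable (g @^-1` [set k]).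

(** A saturated set is the union of the fibres that it meets, and there are countably many. *)
Lemma measurable_saturated (F : set U) :
  (forall z z', g z = g z' -> F z -> F z') -> measurable F.
Proof.
move=> satF; rewrite (_ : F = \bigcup_(k in g @` F) (g @^-1` [set k])).
  rewrite bigcup_mkcond; apply: countable_bigcupT_measurable => // k.
  by case: ifP => _; [exact: mg|exact: measurable0].
apply/seteqP; split => [z Fz|z [k [y Fy <-]]]; first by exists (g z) => //; exists z.
by move=> /= /esym/satF; exact.
Qed.

Lemma le_measure_fibers (R : realType) (m : {measure set U -> \bar R})
    (E F : set U) (c : R) : measurable E -> measurable F -> 0 <= c ->
  (forall k, m (E `&` g @^-1` [set k]) <= c%:E * m (F `&` g @^-1` [set k]))%E ->
  (m E <= c%:E * m F)%E.
Proof.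
(* Fibres are numbered through [pickle] so that countable additivity applies to a series; a number
   that codes no element contributes the empty set. *)
move=> mE mF c0 h; pose D n := [set z | pickle (g z) = n].
have DE n : (exists k, D n = g @^-1` [set k]) \/ D n = set0.
  have [[k kn]|nk] := pselect (exists k : C, pickle k = n); [left|right].
    exists k; apply/seteqP; split => z /=; rewrite /D/= -kn; last by move=> ->.
    by move/(pcan_inj pickleK).
  by rewrite -subset0 => z /= Dz; apply: nk; exists (g z).
have mD n : measurable (D n).
  by have [[k ->]|->] := DE n; [exact: mg|exact: measurable0].
have sumD H : measurable H -> m H = (\sum_(n <oo) m (H `&` D n))%E.
  move=> mH; rewrite -measure_semi_bigcup.
  - congr (m _); apply/seteqP; split => [z Hz|z [n _ []]//].
    by exists (pickle (g z)).
  - by move=> n; exact: measurableI.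
  - apply/trivIsetP => i j _ _ ij; rewrite -subset0 => z [[_ zi] [_ zj]].
    by move: ij; rewrite -zi -zj eqxx.
  - by apply: bigcupT_measurable => n; exact: measurableI.
rewrite (sumD E)// (sumD F)// -nneseriesZl//.
apply: lee_nneseries => n _ //.
by have [[k ->]|->] := DE n => //; rewrite !setI0 !measure0 mule0.
Qed.

End Fibers.

(** * Grids of mesh [4 ^ - N] and the density of sets in their cells *)

Section Grid.
Variable R : realType.
Local Notation w := (width R).
Local Notation RR := (measurableTypeR R * measurableTypeR R)%type.

Definition grid (N : nat) (x : R) : int := Num.floor (x * 4%:R ^+ N).
Definition grid2 (N : nat) (z : RR) : int * int := (grid N z.1, grid N z.2).

Lemma width_gt0 N : 0 < w N.
Proof. by rewrite invr_gt0 exprn_gt0. Qed.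

Lemma widthS N : w N = 4%:R * w N.+1.
Proof. by rewrite /width exprS invfM mulrA divff ?mul1r// pnatr_eq0. Qed.

Lemma gridE N x k : (grid N x == k) = (k%:~R * w N <= x < (k + 1)%:~R * w N).
Proof.
rewrite /grid floor_eq /width ler_pdivrMr ?ltr_pdivlMr ?exprn_gt0//.
Qed.

(** The left end of the coarse cell of [x] is also an end of fine cells, so as a lower bound it
    passes from [x] to [y] through the fine indices. *)
Lemma grid_mono N N' x y : (N <= N')%N -> grid N' x <= grid N' y ->
  grid N x <= grid N y.
Proof.
move=> NN' xy; rewrite /grid floor_ge_int.
have h : (grid N x * 4 ^+ (N' - N))%:~R <= y * 4%:R ^+ N'.
  rewrite -floor_ge_int (le_trans _ xy)// floor_ge_int.
  rewrite intrM rmorphXn/= -[in leRHS](subnKC NN') exprD mulrA.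
  by rewrite ler_wpM2r ?exprn_ge0 ?floor_le.
have := h; rewrite intrM rmorphXn/= -[in leRHS](subnKC NN') exprD mulrA.
by rewrite ler_pM2r ?exprn_gt0.
Qed.

Lemma grid_coarsen N N' x y : (N <= N')%N -> grid N' x = grid N' y ->
  grid N x = grid N y.
Proof.
by move=> NN' xy; apply/le_anti/andP; split; apply: (grid_mono NN');
  rewrite xy.
Qed.

Lemma measurable_grid N k : measurable (grid N @^-1` [set k] : set (measurableTypeR R)).
Proof.
rewrite (_ : _ @^-1` _ = `[k%:~R * w N, (k + 1)%:~R * w N[%classic); last first.
  by apply/seteqP; split => x /=; rewrite in_itv/= -gridE => /eqP.
exact: measurable_itv.
Qed.

Lemma measurable_grid2 N k : measurable (grid2 N @^-1` [set k] : set RR).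
Proof.
rewrite (_ : _ @^-1` _ = grid N @^-1` [set k.1] `*` grid N @^-1` [set k.2]).
  by apply: measurableX; exact: measurable_grid.
apply/seteqP; split => -[x y]; rewrite /grid2/=; first by move=> <-.
by move=> [-> ->]; rewrite -surjective_pairing.
Qed.

(** Unions of cells of one mesh, where the mesh may depend on the set: an algebra that generates the
    Borel sets of the plane. *)
Definition gridalg : set (set RR) := [set F | exists N,
  forall z z', grid2 N z = grid2 N z' -> F z -> F z'].

Lemma grid2_coarsen N N' z z' : (N <= N')%N -> grid2 N' z = grid2 N' z' ->
  grid2 N z = grid2 N z'.
Proof.
by move=> NN' [h1 h2]; congr (_, _); apply: grid_coarsen NN' _.
Qed.

Lemma gridalg_measurable : gridalg `<=` measurable.
Proof.
move=> F [N satF]; apply: (measurable_saturated (measurable_grid2 N)).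
exact: satF.
Qed.

Lemma gridalg0 : gridalg set0.
Proof. by exists 0%N. Qed.

Lemma gridalgC F : gridalg F -> gridalg (~` F).
Proof.
by move=> [N satF]; exists N => z z' zz' nFz Fz'; apply/nFz/(satF z').
Qed.

Lemma gridalgU E F : gridalg E -> gridalg F -> gridalg (E `|` F).
Proof.
move=> [N satE] [M satF]; exists (maxn N M) => z z' zz' [Ez|Fz].
  by left; apply: satE Ez; apply: grid2_coarsen zz'; exact: leq_maxl.
by right; apply: satF Fz; apply: grid2_coarsen zz'; exact: leq_maxr.
Qed.

Lemma gridalgI E F : gridalg E -> gridalg F -> gridalg (E `&` F).
Proof.
by move=> gE gF; rewrite -[E `&` F]setCK setCI; apply/gridalgC/gridalgU;
  exact: gridalgC.
Qed.

(** The floors differ once [(y - x) * 4 ^ n >= 1]; the archimedean bound of [(y - x)^-1] is such an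
    [n], since [n < 4 ^ n]. *)
Lemma grid_separates x y : x < y -> exists N, grid N x < grid N y.
Proof.
move=> xy; have yx0 : 0 < y - x by rewrite subr_gt0.
pose n := Num.bound (y - x)^-1; exists n.
have yx1 : 1 <= (y - x) * 4%:R ^+ n.
  rewrite mulrC -ler_pdivrMr// mul1r.
  apply: (@le_trans _ _ n%:R); first by rewrite ltW// archi_boundP// invr_ge0 ltW.
  by rewrite -natrX ler_nat; exact/ltnW/ltn_expl.
rewrite /grid -lezD1 floor_ge_int intrD.
have := floor_le (x * 4%:R ^+ n); lra.
Qed.

Lemma grid_le N x y : x <= y -> grid N x <= grid N y.
Proof. by move=> xy; apply: le_floor; rewrite ler_wpM2r ?exprn_ge0. Qed.

(** By separation, the preimage of a ray []x, +oo[] under a coordinate is a countable union of sets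
    of the grid algebra; half-open intervals are differences of two rays. *)
Lemma measurable_sub_gridalg : measurable `<=` <<s gridalg >>.
Proof.
have saG := smallest_sigma_algebra setT gridalg; have [sG0 sGD sGU] := saG.
(* Stated for every [f] whose grid index is determined by that of [z], so as to serve both
   projections. *)
have sub (f : RR -> R) :
    (forall N z z', grid2 N z = grid2 N z' -> grid N (f z) = grid N (f z')) ->
    preimage_set_system setT f measurable `<=` <<s gridalg >>.
  move=> fE _ [B mB <-]; rewrite setTI.
  have : <<s @ocitv R >> B by [].
  apply: (@smallest_sub _ _ _ [set B | <<s gridalg >> (f @^-1` B)]).
    split => /=; first by rewrite preimage_set0.
    - by move=> C sC; rewrite setTD preimage_setC -setTD; exact: sGD.
    - by move=> C sC; rewrite preimage_bigcup; exact: sGU.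
  have ray x : <<s gridalg >> (f @^-1` `]x, +oo[).
    rewrite (_ : _ @^-1` _ = \bigcup_N [set z | grid N x < grid N (f z)]).
      apply: sGU => N; apply: sub_sigma_algebra.
      by exists N => z z' /fE/= ->.
    apply/seteqP; split => z /=; rewrite in_itv/= andbT.
      by move=> /grid_separates[N ?]; exists N.
    by move=> [N _ /=]; rewrite !ltNge; apply: contra; exact: grid_le.
  move=> _ [[x y] _ <-] /=.
  rewrite (_ : _ @^-1` _ = ~` (~` (f @^-1` `]x, +oo[) `|` f @^-1` `]y, +oo[)).
    rewrite -setTD; apply: (sGD _); rewrite -bigcup2E; apply: sGU => -[|[|k]] //=.
    by rewrite -setTD; apply: sGD.
  apply/seteqP; split => z /=; rewrite !in_itv/= !andbT.
    by move=> /andP[xz zy] [//|]; rewrite ltNge zy.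
  by move=> /not_orP[/contrapT -> /negP]; rewrite -leNgt.
apply: smallest_sub => // F [|]; apply: sub => N z z' []//.
Qed.

(** Plays the role of the Lebesgue density theorem. [A] is approximated by a union [F'] of cells of
    mesh [N0]; if at some [N >= N0] every cell were filled to at most [1 - e], summing over the
    cells inside [F'] would make [A] and [F'] differ too much. *)
Lemma grid_density (mu : {measure set RR -> \bar R}) (A W : set RR) (e : R) :
  measurable A -> A `<=` W -> gridalg W -> (mu W < +oo)%E -> (0 < mu A)%E ->
  0 < e < 1 ->
  exists N0, forall N, (N0 <= N)%N -> exists k,
    ((1 - e)%:E * mu (grid2 N @^-1` [set k]) < mu (A `&` grid2 N @^-1` [set k]))%E.
Proof.
move=> mA AW gW Woo A0 /andP[e0 e1].
have mW := gridalg_measurable gW.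
have fin E : measurable E -> E `<=` W -> mu E = (fine (mu E))%:E.
  move=> mE EW; rewrite fineK// ge0_fin_numE//; apply: le_lt_trans Woo.
  by apply: le_measure; rewrite ?inE.
(* Restricting [mu] to [W] provides the finite measure that the approximation requires. *)
have mr_fin : (mrestr mu mW setT < +oo)%E by rewrite /mrestr setTI.
have := @approximable_sigma_algebra _ _ _ (mrestr mu mW) gridalg mr_fin
  gridalg_measurable gridalg0 gridalgC gridalgU _ (measurable_sub_gridalg mA).
have Ar0 : 0 < fine (mu A) by rewrite -lte_fin -fin.
(* With [y] the measure of the symmetric difference, [h1] to [h4] combine to
   [e * mu A <= (2 - e) * y], which [y < e * mu A / 2] contradicts. *)
move=> [_ /(_ (e * fine (mu A) / 2))[|F gF]].
  by rewrite divr_gt0// mulr_gt0.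
rewrite /= /mrestr; set d := _ / 2 => AFd.
pose F' := F `&` W; have gF' : gridalg F' by exact: gridalgI.
have mF' := gridalg_measurable gF'.
have mY : measurable (A `+` F') by exact: measurableY.
have YW : A `+` F' `<=` W by move=> z [[/AW]|[[]]].
have {AFd} Yd : fine (mu (A `+` F')) < d.
  rewrite -lte_fin -fin//; apply: le_lt_trans AFd.
  apply: le_measure; rewrite ?inE//.
    apply: measurableI => //; apply: measurableY => //.
    exact: gridalg_measurable.
  move=> z zY; split; last exact: YW.
  by move: zY => [[Az nF]|[[Fz Wz] nA]]; [left|right]; split => // Fz;
    apply: nF; split => //; exact: AW.
have [N0 satF] := gF'; exists N0 => N N0N; apply: contrapT => /forallNP h.
have mAF : measurable (A `&` F') by exact: measurableI.
have : (mu (A `&` F') <= (1 - e)%:E * mu F')%E.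
  apply: (le_measure_fibers (measurable_grid2 N)) => //; first by lra.
  (* As [N >= N0], a cell either lies inside [F'] or misses it. *)
  move=> k; have [[z [Fz zk]]|nF] := pselect (exists z, F' z /\ grid2 N z = k).
    have sub : grid2 N @^-1` [set k] `<=` F'.
      move=> z' /= z'k; apply: satF Fz; apply: grid2_coarsen N0N _.
      by rewrite zk z'k.
    by rewrite -setIA !(setIidr sub) leNgt; apply/negP; exact: h.
  rewrite -setIA (_ : F' `&` _ = set0) ?setI0 ?measure0 ?mule0//.
  by rewrite -subset0 => z [Fz zk]; apply: nF; exists z.
rewrite (fin (A `&` F'))//; last by move=> z [/AW].
rewrite (fin F')//; last by move=> z [].
rewrite -EFinM lee_fin => h1.
have h2 : fine (mu A) <= fine (mu (A `&` F')) + fine (mu (A `+` F')).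
  rewrite -lee_fin EFinD -!fin//; last by move=> z [/AW].
  apply: le_trans (measureU2 _ _ _) => //; apply: le_measure; rewrite ?inE//.
    exact: measurableU.
  by move=> z Az; have [Fz|nFz] := pselect (F' z); [left|right; left].
have h3 : fine (mu F') <= fine (mu A) + fine (mu (A `+` F')).
  rewrite -lee_fin EFinD -!fin//; last by move=> z [].
  apply: le_trans (measureU2 _ _ _) => //; apply: le_measure; rewrite ?inE//.
    exact: measurableU.
  by move=> z Fz; have [Az|nAz] := pselect (A z); [left|right; right].
have h4 : (1 - e) * fine (mu F') <= (1 - e) * (fine (mu A) + fine (mu (A `+` F'))).
  by rewrite ler_wpM2l//; lra.
move: Yd; rewrite /d; nra.
Qed.

End Grid.

(** * Translation invariance of Lebesgue measure on the line and in the plane *)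

Section Translation.
Variable R : realType.
Local Notation RT := (measurableTypeR R).
Local Notation RR := (RT * RT)%type.
Local Notation leb := (@lebesgue_measure R).
Local Notation mu2 := (leb \x leb)%E.

Definition translate (t : R) (x : RT) : RT := (x : R) + t.

Definition translate2 (v : RR) (z : RR) : RR :=
  (translate v.1 z.1, translate v.2 z.2).

Lemma measurable_translate (t : R) : measurable_fun setT (translate t).
Proof. exact: measurable_funD. Qed.

Lemma measurable_translate2 v : measurable_fun setT (translate2 v).
Proof.
apply/measurable_fun_pairP; split.
- exact: (measurableT_comp (measurable_translate v.1) measurable_fst).
- exact: (measurableT_comp (measurable_translate v.2) measurable_snd).
Qed.

Lemma lebesgue_measure_translate (t : R) (A : set RT) : measurable A ->
  leb (translate t @^-1` A) = leb A.
Proof.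
move=> mA; have mf := measurable_translate t.
change (pushforward leb (translate t) A = leb A).
apply/esym/lebesgue_measure_unique => // _ [[x y] _ <-].
rewrite /pushforward/= [X in _ = leb X](_ : _ = `]x - t, y - t]%classic).
  rewrite !lebesgue_measure_itv/= !lte_fin ltrD2r; case: ifPn => // _.
  by rewrite -!EFinD opprB addrA addrNK.
by apply/seteqP; split => z /=; rewrite !in_itv/= ltrBlDr lerBrDr.
Qed.

(** Uniqueness of the product measure reduces the claim to rectangles, hence to the line. *)
Lemma measure_translate2 (v : RR) (A : set RR) : measurable A ->
  mu2 (translate2 v @^-1` A) = mu2 A.
Proof.
move=> mA; have mf := measurable_translate2 v.
apply/esym/(@product_measure_unique _ _ _ _ R leb leb
  (pushforward mu2 (translate2 v))) => // B C mB mC.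
change (mu2 ((translate v.1 @^-1` B) `*` (translate v.2 @^-1` C)) = leb B * leb C)%E.
have mt t (D : set RT) : measurable D -> measurable (translate t @^-1` D).
  by move=> mD; rewrite -[X in measurable X]setTI; exact: measurable_translate.
rewrite product_measure1E; [|exact: mt|exact: mt].
by congr (_ * _)%E; exact: lebesgue_measure_translate.
Qed.

End Translation.

(** * Columns as orderings of grid cells, and the iterates of [T] on levels *)

Section Columns.
Variables (R : realType) (a b c d : nat -> nat).
Local Notation w := (width R).
Local Notation H := (Hgt a b c d).
Local Notation pp := (@Defs.pp a b c d).
Local Notation ll := (@Defs.ll a b c d).
Local Notation qq := (@Defs.qq a b c d).
Local Notation lev := (@Defs.lev R a b c d).
Local Notation level := (@Defs.level R a b c d).
Local Notation col := (@Defs.col R a b c d).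
Local Notation T := (@Defs.T R a b c d).
Local Notation Tinv := (@Defs.Tinv R a b c d).

(* The levels of G_n are the cells [k w_n, (k + 1) w_n[ with k < H_n; icol n
   lists their positions k from bottom to top. *)
Fixpoint icol (n : nat) : seq nat :=
  match n with
  | 0 => [:: 0%N]
  | n'.+1 =>
    let C := icol n' in
    let s := (4 * H n')%N in
    [seq (4 * x)%N | x <- C] ++ iota s (a n')
      ++ [seq (4 * x + 1)%N | x <- C] ++ iota (s + a n') (b n')
      ++ [seq (4 * x + 2)%N | x <- C] ++ iota (s + (a n' + b n')) (c n')
      ++ [seq (4 * x + 3)%N | x <- C] ++ iota (s + (a n' + b n' + c n')) (d n')
  end.

Definition pos n j := nth 0%N (icol n) j.

(* height in G_{n+1} of the bottom of the copy s of G_n, s = 0, ..., 3 *)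
Definition copy n (s : nat) : nat :=
  match s with
  | 0 => 0
  | 1 => pp n
  | 2 => pp n + ll n
  | _ => pp n + ll n + qq n
  end.

Lemma Hgt_gt0 n : (0 < H n)%N.
Proof. by elim: n => //= n IH; rewrite !addn_gt0 IH. Qed.

Lemma size_icol n : size (icol n) = H n.
Proof.
elim: n => [//|n IH].
rewrite [icol _]/= !size_cat !size_map !size_iota IH /=; lia.
Qed.

(** Quarter [s] of the cell of index [k] has index [4 * k + s] in the next mesh, and it is the part
    that goes into subcolumn [s]. *)
Lemma pos_copy n i s : (i < H n)%N -> (s < 4)%N ->
  pos n.+1 (copy n s + i) = (4 * pos n i + s)%N.
Proof.
move=> iH s4; rewrite /pos [icol n.+1]/= /copy.
rewrite !nth_cat !size_map !size_iota !size_icol /Defs.pp /Defs.ll /Defs.qq.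
have nm (f : nat -> nat) : nth 0%N [seq f x | x <- icol n] i = f (nth 0%N (icol n) i).
  by rewrite (nth_map 0%N)// size_icol.
case: s s4 => [|[|[|[|//]]]] _.
- by rewrite add0n iH nm addn0.
- do 2 (case: ifPn => [|_]; first by lia).
  rewrite (_ : _ - _ - _ = i)%N; last by lia.
  by rewrite iH nm.
- do 4 (case: ifPn => [|_]; first by lia).
  rewrite (_ : _ - _ - _ = i)%N; last by lia.
  by rewrite iH nm.
- do 6 (case: ifPn => [|_]; first by lia).
  rewrite (_ : _ - _ - _ = i)%N; last by lia.
  by rewrite iH nm.
Qed.

Lemma copy_lt n i s : (i < H n)%N -> (copy n s + i < H n.+1)%N.
Proof.
rewrite /copy /= /Defs.pp /Defs.ll /Defs.qq => iH.
by case: s => [|[|[|s]]]; lia.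
Qed.

(** An index below [4 * H n] comes from its quotient by 4, the remainder naming the subcolumn; the
    larger indices are the new spacers. *)
Lemma iota_sub_icol n : {subset iota 0 (H n) <= icol n}.
Proof.
elim: n => [//|n IH] x; rewrite mem_iota add0n => xH.
rewrite [icol _]/= !mem_cat !mem_iota.
have [x4|x4] := ltnP x (4 * H n); last first.
  do 4 case: (x \in map _ _); rewrite ?orbT//=; move: xH; rewrite /=; lia.
have xn : (x %/ 4 \in icol n)%N by apply: IH; rewrite mem_iota; lia.
have mf (f : nat -> nat) : x = f (x %/ 4)%N -> x \in [seq f x | x <- icol n].
  by move=> ->; exact: map_f.
have : (x %% 4 < 4)%N by rewrite ltn_mod.
case E : (x %% 4)%N => [|[|[|[|//]]]] _.
- by rewrite (mf (fun x => 4 * x)%N)//; lia.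
- by rewrite (mf (fun x => 4 * x + 1)%N) ?orbT//; lia.
- by rewrite (mf (fun x => 4 * x + 2)%N) ?orbT//; lia.
- by rewrite (mf (fun x => 4 * x + 3)%N) ?orbT//; lia.
Qed.

(** A list of [H n] entries that contains all of [0, ..., H n - 1] cannot repeat any. *)
Lemma icol_uniq n : uniq (icol n).
Proof.
apply: (leq_size_uniq (iota_uniq 0 (H n)) (@iota_sub_icol n)).
by rewrite size_iota size_icol.
Qed.

Lemma pos_surj n k : (k < H n)%N -> exists2 j, (j < H n)%N & pos n j = k.
Proof.
move=> kH; have kI : k \in icol n by apply: iota_sub_icol; rewrite mem_iota.
by exists (index k (icol n)); [rewrite -size_icol index_mem|exact: nth_index].
Qed.

Lemma pos_lt n j : (j < H n)%N -> (pos n j < H n)%N.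
Proof.
move=> jH; have /uniq_min_size := @iota_uniq 0 (H n).
move=> /(_ _ (@iota_sub_icol n)); rewrite size_iota size_icol => /(_ (leqnn _))[_ e].
have : pos n j \in icol n by rewrite mem_nth// size_icol.
by rewrite -e mem_iota.
Qed.

Lemma pos_inj n i j : (i < H n)%N -> (j < H n)%N -> pos n i = pos n j -> i = j.
Proof.
by move=> iH jH /eqP; rewrite nth_uniq ?size_icol ?icol_uniq// => /eqP.
Qed.

(** The levels of [G_n] fill the interval from 0 to [H n * w n], and fresh spacers start at its
    right end. *)
Lemma spstartE n : @spstart R a b c d n = (H n)%:R * w n.
Proof.
elim: n => [|n IH] /=; first by rewrite /width expr0 invr1 mulr1.
rewrite IH widthS mulrA -mulrDl -natrM -natrD; congr (_%:R * _); lia.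
Qed.

Lemma spacersE k m v : spacers (m%:R * v) k v = [seq x%:R * v | x <- iota m k] :> seq R.
Proof.
rewrite /spacers -[in RHS](addn0 m) iotaDl -map_comp; apply: eq_map => i /=.
by rewrite natrD mulrDl.
Qed.

Lemma colE n : col n = [seq x%:R * w n | x <- icol n].
Proof.
elim: n => [|n IH]; first by rewrite /= mul0r.
rewrite [icol _]/= !map_cat -!spacersE -!map_comp [col _]/= IH spstartE -!map_comp.
have e k : (H n)%:R * w n + k%:R * w n.+1 = (4 * H n + k)%N%:R * w n.+1.
  by rewrite natrD natrM widthS; ring.
have e0 : (H n)%:R * w n = (4 * H n)%N%:R * w n.+1 by rewrite natrM widthS; ring.
rewrite !e e0.
congr (_ ++ (_ ++ (_ ++ (_ ++ (_ ++ (_ ++ (_ ++ _))))))); apply: eq_map => x;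
  rewrite /= (widthS R n); [rewrite natrM|rewrite natrD natrM..]; ring.
Qed.

Lemma size_col n : size (col n) = H n.
Proof. by rewrite colE size_map size_icol. Qed.

Lemma levE n j : (j < H n)%N -> lev n j = (pos n j)%:R * w n.
Proof. by move=> jH; rewrite /Defs.lev colE (nth_map 0%N)// size_icol. Qed.

Lemma lev_copy n i s : (i < H n)%N -> (s < 4)%N ->
  lev n.+1 (copy n s + i) = lev n i + s%:R * w n.+1.
Proof.
move=> iH s4; rewrite !levE ?copy_lt// pos_copy// natrD natrM (widthS R n); ring.
Qed.

Lemma level_grid n j : (j < H n)%N -> level n j = grid n @^-1` [set (pos n j)%:Z].
Proof.
move=> jH; rewrite /Defs.level levE//; apply/seteqP; split => x /=.
  by move=> [h1 h2]; apply/eqP; rewrite gridE; apply/andP; split=> //;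
    rewrite intrD mulrDl mul1r.
by move/eqP; rewrite gridE => /andP[-> ]; rewrite intrD mulrDl mul1r.
Qed.

Lemma level_inj n i j x : (i < H n)%N -> (j < H n)%N ->
  level n i x -> level n j x -> i = j.
Proof.
move=> iH jH; rewrite !level_grid//= => -> [e]; exact: pos_inj e.
Qed.

Lemma level_copy n i x : (i < H n)%N -> level n i x ->
  exists2 s, (s < 4)%N & level n.+1 (copy n s + i) x.
Proof.
move=> iH; rewrite /Defs.level/= widthS => -[h1 h2].
have e s := @lev_copy n i s iH.
have [l1|l1] := ltP x (lev n i + 1%:R * w n.+1).
  by exists 0%N => //; rewrite e//; lra.
have [l2|l2] := ltP x (lev n i + 2%:R * w n.+1).
  by exists 1%N => //; rewrite e//; lra.
have [l3|l3] := ltP x (lev n i + 3%:R * w n.+1).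
  by exists 2%N => //; rewrite e//; lra.
by exists 3%N => //; rewrite e//; lra.
Qed.

(** At each stage both levels are followed into the same copy, which keeps their difference in
    height and the translation between them. *)
Lemma level_refine n N i j x : (n <= N)%N -> (i < H n)%N -> (j < H n)%N ->
  level n i x -> exists I J, [/\ (I < H N)%N, (J < H N)%N, level N I x,
    (I + j = J + i)%N & lev N J - lev N I = lev n j - lev n i].
Proof.
move=> nN iH jH xi; elim: N nN => [|N IH].
  by rewrite leqn0 => /eqP n0; move: iH jH xi; rewrite n0; exists i, j; split=> //; lia.
rewrite leq_eqVlt => /predU1P[<-|/IH[I [J [IH' JH xI IJ e]]]].
  by exists i, j; split=> //; lia.
have [s s4 xs] := level_copy IH' xI.
exists (copy N s + I)%N, (copy N s + J)%N; split; rewrite ?copy_lt//.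
  by lia.
by rewrite !lev_copy// -e; lra.
Qed.

(** Both pairs are refined to stage [maxn n n'], where the level containing [x] is unique. Hence the
    values of [T] and [Tinv] do not depend on the column picked by choice. *)
Lemma level_shift_indep n i j n' i' j' x : (i < H n)%N -> (j < H n)%N ->
  (i' < H n')%N -> (j' < H n')%N -> level n i x -> level n' i' x ->
  (i + j' = i' + j)%N -> lev n j - lev n i = lev n' j' - lev n' i'.
Proof.
move=> iH jH i'H j'H xi xi' e.
have [I [J [IH JH xI IJ <-]]] := level_refine (leq_maxl n n') iH jH xi.
have [I' [J' [I'H J'H xI' IJ' <-]]] := level_refine (leq_maxr n n') i'H j'H xi'.
by have II := level_inj IH I'H xI xI'; subst I'; have -> : J = J' by lia.
Qed.

Lemma T_level n j x : (j.+1 < H n)%N -> level n j x ->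
  T x = x - lev n j + lev n j.+1.
Proof.
move=> jH xj; rewrite /Defs.T; case: pselect => [e|[]]; last first.
  by exists (n, j); split => //=; rewrite size_col.
case: cid => -[n' j'] [/= j'H xj']; rewrite size_col in j'H.
have := @level_shift_indep n j j.+1 n' j' j'.+1 x (ltnW jH) jH (ltnW j'H) j'H xj xj'.
by move=> /(_ ltac:(lia)); lra.
Qed.

Lemma Tinv_level n j x : (j.+1 < H n)%N -> level n j.+1 x ->
  Tinv x = x - lev n j.+1 + lev n j.
Proof.
move=> jH xj; rewrite /Defs.Tinv; case: pselect => [e|[]]; last first.
  by exists (n, j.+1); split => //=; rewrite size_col.
case: cid => -[n' j'] [/= j0 [j'H xj']]; rewrite size_col in j'H.
have := @level_shift_indep n j.+1 j n' j' j'.-1 x jH (ltnW jH) j'H _ xj xj'.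
by move=> /(_ ltac:(lia) ltac:(lia)); lra.
Qed.

Lemma level_translate n i j x : level n i x -> level n j (x - lev n i + lev n j).
Proof. by rewrite /Defs.level/= => -[h1 h2]; split; lra. Qed.

Lemma iter_T_level n j k x : (j + k < H n)%N -> level n j x ->
  iter k T x = x - lev n j + lev n (j + k).
Proof.
move=> jk xj; elim: k jk => [_|k IH jk]; first by rewrite addn0 /= subrK.
rewrite iterS IH; last by lia.
rewrite (@T_level n (j + k)); [|by lia|exact: level_translate].
by rewrite addnS; lra.
Qed.

Lemma iter_Tinv_level n j k x : (j + k < H n)%N -> level n (j + k) x ->
  iter k Tinv x = x - lev n (j + k) + lev n j.
Proof.
elim: k j => [|k IH] j jk xj; first by rewrite addn0 /= subrK.
rewrite iterS (IH j.+1); [|by lia|by rewrite addSnnS].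
rewrite (@Tinv_level n j); [|by lia|].
  by rewrite addSnnS; lra.
by apply: level_translate; rewrite addSnnS.
Qed.

End Columns.

(** * Squares of levels and the portion of them that a set fills *)

Section Squares.
Variables (R : realType) (a b c d : nat -> nat).
Local Notation RT := (measurableTypeR R).
Local Notation RR := (RT * RT)%type.
Local Notation leb := (@lebesgue_measure R).
Local Notation mu2 := (leb \x leb)%E.
Local Notation w := (width R).
Local Notation H := (Hgt a b c d).
Local Notation lev := (@Defs.lev R a b c d).
Local Notation level := (@Defs.level R a b c d).
Local Notation X := (@rk_space R a b c d).
Local Notation copy := (copy a b c d).
Local Notation pos := (pos a b c d).

Lemma measurable_level n j : measurable (level n j : set RT).
Proof.
rewrite (_ : level n j = `[lev n j, lev n j + w n[%classic).
  exact: measurable_itv.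
by apply/seteqP; split => x /=; rewrite in_itv/= => /andP.
Qed.

Lemma lebesgue_measure_level n j : leb (level n j) = (w n)%:E.
Proof.
rewrite (_ : level n j = `[lev n j, lev n j + w n[%classic); last first.
  by apply/seteqP; split => x /=; rewrite in_itv/= => /andP.
rewrite lebesgue_measure_itv/= lte_fin ltrDl width_gt0 -EFinD.
by congr (_%:E); lra.
Qed.

Lemma measurable_rk_space : measurable (X : set RT).
Proof.
rewrite (_ : X = \bigcup_n \bigcup_(j in `I_(size (@Defs.col R a b c d n))) level n j).
  apply: bigcupT_measurable => n; apply: bigcup_measurable => j _.
  exact: measurable_level.
apply/seteqP; split => x.
  by move=> [n [j [jn xj]]]; exists n => //; exists j.
by move=> [n _ [j jn xj]]; exists n, j.
Qed.

Definition square n i j : set RR := level n i `*` level n j.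

(** For measurable [E], [fine] loses nothing, because a square has finite measure. *)
Definition mass (E : set RR) n i j : R := fine (mu2 (E `&` square n i j)).

Lemma measurable_square n i j : measurable (square n i j).
Proof. by apply: measurableX; exact: measurable_level. Qed.

Lemma measure_square n i j : mu2 (square n i j) = (w n * w n)%:E.
Proof.
transitivity (leb (level n i) * leb (level n j))%E.
  by apply: product_measure1E; exact: measurable_level.
by rewrite !lebesgue_measure_level.
Qed.

Lemma measure_sub_square (E : set RR) n i j : measurable E -> E `<=` square n i j ->
  mu2 E = (fine (mu2 E))%:E.
Proof.
move=> mE Es; rewrite fineK// ge0_fin_numE ?measure_ge0//.
apply: (@le_lt_trans _ _ (mu2 (square n i j))); last by rewrite measure_square ltry.
by apply: le_measure; rewrite ?inE//; exact: measurable_square.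
Qed.

Lemma massE E n i j : measurable E -> mu2 (E `&` square n i j) = (mass E n i j)%:E.
Proof.
move=> mE; apply: (@measure_sub_square _ n i j); last exact: subIsetr.
by apply: measurableI => //; exact: measurable_square.
Qed.

Lemma massC E n i j : measurable E -> mass (~` E) n i j = w n * w n - mass E n i j.
Proof.
move=> mE; have mq := measurable_square n i j.
suff : (w n * w n)%:E = ((mass E n i j) + mass (~` E) n i j)%:E :> \bar R.
  by move=> [->]; lra.
rewrite EFinD -!massE//; last exact: measurableC.
rewrite -(measure_square n i j) -measureU; first by rewrite -setIUl setUv setTI.
- exact: measurableI.
- by apply: measurableI => //; exact: measurableC.
- by rewrite -subset0 => z [[Ez _] []].
Qed.

Lemma square_copy n i j s s' : (i < H n)%N -> (j < H n)%N -> (s < 4)%N -> (s' < 4)%N ->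
  square n.+1 (copy n s + i) (copy n s' + j) `<=` square n i j.
Proof.
have sub i' t x : (i' < H n)%N -> (t < 4)%N ->
    level n.+1 (copy n t + i') x -> level n i' x.
  move=> iH t4; rewrite /Defs.level/= lev_copy// (widthS R n) => -[h1 h2].
  have w0 := width_gt0 R n.+1.
  have t0 : 0 <= t%:R * w n.+1 by rewrite mulr_ge0// ltW.
  have t3 : t%:R * w n.+1 <= 3%:R * w n.+1 by rewrite ler_pM2r// ler_nat.
  by split; lra.
by move=> iH jH s4 s'4 z [z1 z2]; split; [exact: sub z1|exact: sub z2].
Qed.

Lemma mass_copy_le E n i j s s' : measurable E ->
  (i < H n)%N -> (j < H n)%N -> (s < 4)%N -> (s' < 4)%N ->
  mass E n.+1 (copy n s + i) (copy n s' + j) <= mass E n i j.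
Proof.
move=> mE iH jH s4 s'4; rewrite -lee_fin -!massE//.
apply: le_measure; rewrite ?inE.
- by apply: measurableI => //; exact: measurable_square.
- by apply: measurableI => //; exact: measurable_square.
- by apply: setIS; exact: square_copy.
Qed.

(** The 16 products of copies partition the square: [split] cuts it into four along the first
    coordinate, then each strip into four along the second. *)
Lemma mass_copy E n i j : measurable E -> (i < H n)%N -> (j < H n)%N ->
  mass E n i j =
  \sum_(s < 4) \sum_(s' < 4) mass E n.+1 (copy n s + i) (copy n s' + j).
Proof.
move=> mE iH jH; apply: EFin_inj; rewrite -massE//.
have mq k u v : measurable (E `&` square k u v).
  by apply: measurableI => //; exact: measurable_square.
have split (V : set RR) (F : nat -> set RR) : measurable V ->
    (forall s, measurable (F s)) ->
    (forall s s' z, (s < 4)%N -> (s' < 4)%N -> F s z -> F s' z -> s = s') ->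
    (forall z, V z -> exists2 s, (s < 4)%N & F s z) ->
    mu2 V = (\sum_(s < 4) mu2 (V `&` F s))%E.
  move=> mV mF dF VF.
  rewrite -(@measure_bigsetU_ord _ _ _ _ _ predT (fun s : 'I_4 => V `&` F s)).
  - rewrite -(bigcup_mkord 4 (fun s => V `&` F s)); congr (mu2 _).
    apply/seteqP; split => [z Vz|z [s _ []]//].
    by have [s s4 Fz] := VF z Vz; exists s.
  - by move=> s; exact: measurableI.
  - move=> s s' _ _ [z [[_ Fz] [_ F'z]]]; apply: val_inj => /=.
    exact: dF Fz F'z.
have inj i' s s' x : (i' < H n)%N -> (s < 4)%N -> (s' < 4)%N ->
    level n.+1 (copy n s + i') x -> level n.+1 (copy n s' + i') x -> s = s'.
  move=> iH' s4 s'4; rewrite !level_grid ?copy_lt//= => -> [].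
  by rewrite !pos_copy// => /addnI.
rewrite (split _ (fun s => level n.+1 (copy n s + i) `*` setT))//; first last.
- by move=> z [_ [z1 _]]; have [s s4 ?] := level_copy iH z1; exists s.
- by move=> s s' z s4 s'4 [+ _] [+ _]; exact: inj.
- by move=> s; apply: measurableX => //; exact: measurable_level.
rewrite -sumEFin; apply: eq_bigr => s _.
rewrite (split _ (fun s' => setT `*` level n.+1 (copy n s' + j)))//; first last.
- by move=> z [[_ [_ z2]] _]; have [s' s'4 ?] := level_copy jH z2; exists s'.
- by move=> s1 s' z s4 s'4 [_ +] [_ +]; exact: inj.
- by move=> s'; apply: measurableX => //; exact: measurable_level.
- apply: measurableI => //; apply: measurableX => //; exact: measurable_level.
rewrite -sumEFin; apply: eq_bigr => s' _; rewrite -massE//; congr (mu2 _).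
apply/seteqP; split => [z [[[Ez _] [z1 _]] [_ z2]]//|z [Ez z12]].
have zs := square_copy iH jH (ltn_ord s) (ltn_ord s') z12.
by case: z12 => z1 z2.
Qed.

Lemma sum_lt_exists n (f : 'I_n -> 'I_n -> R) (C : R) :
  \sum_s \sum_s' f s s' < (n * n)%:R * C -> exists s s', f s s' < C.
Proof.
move=> h; apply: contrapT => nh; move: h; rewrite ltNge => /negP; apply.
apply: (@le_trans _ _ (\sum_(s < n) \sum_(s' < n) C)).
  by rewrite !sumr_const !card_ord -mulrnA mulr_natl.
apply: ler_sum => s _; apply: ler_sum => s' _; rewrite leNgt; apply/negP => fC.
by apply: nh; exists s, s'.
Qed.

(* Sum over the 16 pairs of corresponding subsquares: one of them is at least
   as good as the average, and passing to it keeps the relative positions of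
   the two squares. *)
Lemma mass_pair_refine (E F : set RR) (C : R) n N i i' j j' :
  measurable E -> measurable F -> (n <= N)%N ->
  (i < H n)%N -> (i' < H n)%N -> (j < H n)%N -> (j' < H n)%N ->
  mass E n i j + mass F n i' j' < C * (w n * w n) ->
  exists I I' J J', [/\ [/\ (I < H N)%N, (I' < H N)%N, (J < H N)%N & (J' < H N)%N],
    (I + i' = I' + i)%N, (J + j' = J' + j)%N &
    mass E N I J + mass F N I' J' < C * (w N * w N)].
Proof.
move=> mE mF nN iH i'H jH j'H h; elim: N nN => [|N IH].
  rewrite leqn0 => /eqP n0; subst n.
  by exists i, i', j, j'; split=> //; lia.
rewrite leq_eqVlt => /predU1P[<-|/IH[I [I' [J [J' [[IH' I'H JH J'H] eI eJ]]]]]].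
  by exists i, i', j, j'; split=> //; lia.
rewrite (mass_copy mE)// (mass_copy mF)// -big_split/=.
under eq_bigr do rewrite -big_split/=.
rewrite (widthS R N) (_ : C * _ = (4 * 4)%:R * (C * (w N.+1 * w N.+1))); last first.
  by rewrite natrM; ring.
move=> /sum_lt_exists[s [s' hs]].
exists (copy N s + I)%N, (copy N s + I')%N, (copy N s' + J)%N, (copy N s' + J')%N.
by split=> //; [split; exact: copy_lt|lia|lia].
Qed.

(** The product of the column [G_n] with itself, described by grid indices so that it belongs to the
    grid algebra. It has finite measure, and the windows increase with [n] and cover [X x X]. *)
Definition window n : set RR :=
  [set z | (0 <= grid n z.1 < (H n)%:Z) && (0 <= grid n z.2 < (H n)%:Z)].

Lemma gridalg_window n : gridalg (window n).
Proof. by exists n => z z' [h1 h2]; rewrite /window/= h1 h2. Qed.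

Lemma measurable_window n : measurable (window n).
Proof. exact: (gridalg_measurable (gridalg_window n)). Qed.

Lemma grid_level n x : (0 <= grid n x < (H n)%:Z) <->
  exists2 j, (j < H n)%N & level n j x.
Proof.
split => [|[j jH]]; last first.
  by rewrite level_grid//= => ->; rewrite ltz_nat pos_lt.
case E : (grid n x) => [k|//] /andP[_ kH].
have [j jH jk] := pos_surj kH.
by exists j => //; rewrite level_grid//= jk.
Qed.

Lemma level_mono n N j x : (n <= N)%N -> (j < H n)%N -> level n j x ->
  exists2 J, (J < H N)%N & level N J x.
Proof.
move=> nN jH xj.
by have [J [_ [JH _ xJ _ _]]] := level_refine nN jH jH xj; exists J.
Qed.

Lemma window_mono n N : (n <= N)%N -> window n `<=` window N.
Proof.
move=> nN z /andP[/grid_level[j jH z1] /grid_level[j' j'H z2]].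
by apply/andP; split; apply/grid_level; [exact: level_mono z1|exact: level_mono z2].
Qed.

Lemma rk_space_window : X `*` X `<=` \bigcup_n window n.
Proof.
move=> z [[n [j [jH z1]]] [n' [j' [j'H z2]]]]; rewrite size_col in jH.
rewrite size_col in j'H; exists (maxn n n') => //; apply/andP; split; apply/grid_level.
- by apply: level_mono z1 => //; exact: leq_maxl.
- by apply: level_mono z2 => //; exact: leq_maxr.
Qed.

Lemma measure_window_fin n : (mu2 (window n) < +oo)%E.
Proof.
pose I : set RT := `[0, (H n)%:R * w n[%classic.
have mI : measurable I by exact: measurable_itv.
apply: (@le_lt_trans _ _ (mu2 (I `*` I))).
  apply: le_measure; rewrite ?inE.
  - exact: measurable_window.
  - exact: measurableX.
  have sub x : 0 <= grid n x < (H n)%:Z -> I x.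
    move=> /andP[g0 gH]; rewrite /I/= in_itv/=.
    have /andP[h1 h2] : (grid n x)%:~R * w n <= x < (grid n x + 1)%:~R * w n.
      by rewrite -gridE.
    have w0 := width_gt0 R n; apply/andP; split.
      by apply: le_trans h1; rewrite mulr_ge0 ?ler0z// ltW.
    apply: lt_le_trans h2 _; rewrite ler_pM2r//.
    by rewrite -[X in _ <= X]/((H n)%:Z%:~R) ler_int lezD1.
  by move=> z /andP[z1 z2]; split; exact: sub.
have -> : mu2 (I `*` I) = (leb I * leb I)%E by exact: product_measure1E.
rewrite lebesgue_measure_itv/= lte_fin; case: ifPn => _; last by rewrite mul0e.
by rewrite -EFinB -EFinM ltry.
Qed.

Lemma good_square (A : set RR) (e : R) : measurable A -> A `<=` X `*` X ->
  (0 < mu2 A)%E -> 0 < e < 1 ->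
  exists N0, forall N, (N0 <= N)%N -> exists i j,
    [/\ (i < H N)%N, (j < H N)%N & mass (~` A) N i j < e * (w N * w N)].
Proof.
move=> mA AX A0 e01.
have mW n : measurable (window n) by exact: measurable_window.
(* Density needs a region of finite measure: countably many windows cover [A], so one of them meets
   it in positive measure. *)
have [n An0] : exists n, (0 < mu2 (A `&` window n))%E.
  apply: contrapT => /forallNP h.
  suff : mu2 A = 0%E by move=> A00; rewrite A00 ltxx in A0.
  have -> : A = \bigcup_n (A `&` window n).
    by rewrite -setI_bigcupr; apply/esym/setIidl; apply: subset_trans rk_space_window.
  apply: measure_negligible; first by apply: bigcupT_measurable => k; exact: measurableI.
  apply: negligible_bigcup => k; apply/negligibleP; first exact: measurableI.
  by apply/eqP; rewrite -measure_le0 leNgt; apply/negP; exact: h.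
have mAn : measurable (A `&` window n) by exact: measurableI.
have [N0 hN] := @grid_density R mu2 _ _ e mAn (@subIsetr _ _ _) (gridalg_window n)
  (measure_window_fin n) An0 e01.
exists (maxn N0 n) => N; rewrite geq_max => /andP[N0N nN].
have [k hk] := hN N N0N.
(* The cell given by density has to be a square of levels. It contains a point of [window n], hence
   of [window N] as [n <= N], and this identifies it. *)
have [z [[_ zW] zk]] : (A `&` window n) `&` grid2 N @^-1` [set k] !=set0.
  apply/set0P/negP => /eqP A0'; move: hk; rewrite A0' measure0 ltNge => /negP; apply.
  by rewrite mule_ge0 ?measure_ge0// lee_fin; lra.
have /andP[/grid_level[i iH zi] /grid_level[j jH zj]] := window_mono nN zW.
have kE : grid2 N @^-1` [set k] = square N i j.
  rewrite /square !level_grid//; move: zi zj zk; rewrite !level_grid//=.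
  rewrite /grid2 => -> -> <-.
  by apply/seteqP; split => -[x y]/= => [[-> ->]|[-> ->]].
exists i, j; split=> //; rewrite massC//.
have : ((1 - e)%:E * mu2 (square N i j) <
    mu2 ((A `&` window n) `&` square N i j))%E by rewrite -kE; exact: hk.
rewrite measure_square -EFinM.
have le : (mu2 ((A `&` window n) `&` square N i j) <= (mass A N i j)%:E)%E.
  rewrite -massE//; apply: le_measure; rewrite ?inE.
  - by apply: measurableI => //; exact: measurable_square.
  - by apply: measurableI => //; exact: measurable_square.
  - by move=> y [[]].
by move=> /lt_le_trans/(_ le); rewrite lte_fin; lra.
Qed.

(** Prescribing the copies lets the sign of the offset between the two squares be chosen in each
    coordinate. *)
Lemma good_square_pair (A B : set RR) s1 s1' s2 s2' :
  (s1 < 4)%N -> (s1' < 4)%N -> (s2 < 4)%N -> (s2' < 4)%N ->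
  measurable A -> measurable B -> A `<=` X `*` X -> B `<=` X `*` X ->
  (0 < mu2 A)%E -> (0 < mu2 B)%E ->
  exists N i i' j j', [/\ (i < H N)%N, (i' < H N)%N, (j < H N)%N & (j' < H N)%N] /\
    mass (~` A) N.+1 (copy N s1 + i) (copy N s2 + j) +
    mass (~` B) N.+1 (copy N s1' + i') (copy N s2' + j')
      < 16%:R^-1 * (w N.+1 * w N.+1).
Proof.
move=> s14 s1'4 s24 s2'4 mA mB AX BX A0 B0.
(* Passing to a subsquare multiplies the relative loss by at most 16, and two losses of [16 / 512]
   add up to [1 / 16]. *)
have e01 : 0 < (512%:R^-1 : R) < 1 by lra.
have [NA hA] := good_square mA AX A0 e01.
have [NB hB] := good_square mB BX B0 e01.
have [i [j [iH jH hi]]] := hA _ (leq_maxl NA NB).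
have [i' [j' [i'H j'H hi']]] := hB _ (leq_maxr NA NB).
exists (maxn NA NB), i, i', j, j'; split=> //.
have := mass_copy_le (measurableC mA) iH jH s14 s24.
have := mass_copy_le (measurableC mB) i'H j'H s1'4 s2'4.
move: hi hi'; rewrite (widthS R (maxn NA NB)); lra.
Qed.

(* The two sets miss less than the area of the subsquares, hence meet once S
   has translated one subsquare onto the other. *)
Lemma return_square (A B : set RR) (S : RR -> RR) n i i' j j' s1 s1' s2 s2' :
  (s1 < 4)%N -> (s1' < 4)%N -> (s2 < 4)%N -> (s2' < 4)%N ->
  measurable A -> measurable B -> measurable_fun setT S ->
  (i < H n)%N -> (i' < H n)%N -> (j < H n)%N -> (j' < H n)%N ->
  mass (~` A) n i j + mass (~` B) n i' j' < 16%:R^-1 * (w n * w n) ->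
  (forall z, square n.+1 (copy n s1 + i) (copy n s2 + j) z ->
    S z = (z.1 - lev n.+1 (copy n s1 + i) + lev n.+1 (copy n s1' + i'),
           z.2 - lev n.+1 (copy n s2 + j) + lev n.+1 (copy n s2' + j'))) ->
  (0 < mu2 (S @^-1` B `&` A))%E.
Proof.
move=> s14 s1'4 s24 s2'4 mA mB mS iH i'H jH j'H h SE.
have := mass_copy_le (measurableC mA) iH jH s14 s24.
have := mass_copy_le (measurableC mB) i'H j'H s1'4 s2'4.
move: SE; set u := (copy n s1 + i)%N; set v := (copy n s2 + j)%N.
set u' := (copy n s1' + i')%N; set v' := (copy n s2' + j')%N => SE hB hA.
have mq k x y : measurable (square k x y) by exact: measurable_square.
have mSB : measurable (S @^-1` B) by rewrite -[X in measurable X]setTI; exact: mS.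
pose D : set RR := ~` B `&` square n.+1 u' v'.
have mD : measurable D by apply: measurableI => //; exact: measurableC.
pose t : RR := (lev n.+1 u' - lev n.+1 u, lev n.+1 v' - lev n.+1 v).
have mtD : measurable (translate2 t @^-1` D).
  by rewrite -[X in measurable X]setTI; exact: measurable_translate2.
(* A point of the source square that is not counted in the return set is missed by [A] or carried to
   a point of the target square missed by [B]. *)
have sub : square n.+1 u v `<=`
    (S @^-1` B `&` A) `|` ((~` A `&` square n.+1 u v) `|` translate2 t @^-1` D).
  move=> z zq; have [Az|nAz] := pselect (A z); last by right; left.
  have [BSz|nBSz] := pselect (B (S z)); first by left.
  right; right; rewrite /D/=.
  have -> : translate2 t z = S z.
    by rewrite SE// /translate2 /translate /t/=; congr (_, _); ring.
  split=> //; rewrite SE//; case: zq => z1 z2.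
  by split; apply: level_translate.
rewrite ltNge; apply/negP => le0.
have : ((w n.+1 * w n.+1)%:E <=
    0 + ((mass (~` A) n.+1 u v)%:E + (mass (~` B) n.+1 u' v')%:E))%E.
  rewrite -(measure_square n.+1 u v).
  apply: le_trans (le_measure _ _ _ sub) _; rewrite ?inE//.
    apply: measurableU; first exact: measurableI.
    by apply: measurableU => //; apply: measurableI => //; exact: measurableC.
  apply: le_trans (measureU2 _ _ _) _.
  - exact: measurableI.
  - by apply: measurableU => //; apply: measurableI => //; exact: measurableC.
  apply: leeD => //; apply: le_trans (measureU2 _ _ _) _ => //.
  - by apply: measurableI => //; exact: measurableC.
  apply: leeD; first by have <- := massE n.+1 u v (measurableC mA).
  have <- := massE n.+1 u' v' (measurableC mB).
  by have <- := measure_translate2 t mD.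
rewrite add0e -EFinD lee_fin.
(* The bound in [h] is exactly the area of one subsquare, since [w n = 4 * w n.+1]. *)
by move: h; rewrite (widthS R n); have := width_gt0 R n.+1; nra.
Qed.

End Squares.

(** * Measurability of the powers and reduction to a hitting property *)

Section Powers.
Variables (R : realType) (a b c d : nat -> nat).
Local Notation RT := (measurableTypeR R).
Local Notation RR := (RT * RT)%type.
Local Notation mu2 := (@lebesgue_measure R \x @lebesgue_measure R)%E.
Local Notation H := (Hgt a b c d).
Local Notation lev := (@Defs.lev R a b c d).
Local Notation level := (@Defs.level R a b c d).
Local Notation T := (@Defs.T R a b c d).
Local Notation Tinv := (@Defs.Tinv R a b c d).
Local Notation X := (@rk_space R a b c d).
Local Notation copy := (copy a b c d).

(** A preimage splits into countably many translated pieces and a part where [f] is the identity.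
    The [D k] may overlap, as levels of different columns do. *)
Lemma measurable_fun_piecewise_translation (f : RT -> RT)
    (D : nat * nat -> set RT) (t : nat * nat -> R) :
  (forall k, measurable (D k)) ->
  (forall k x, D k x -> f x = translate (t k) x) ->
  (forall x, (forall k, ~ D k x) -> f x = x) -> measurable_fun setT f.
Proof.
move=> mD fD fN _ Y mY; rewrite setTI.
rewrite (_ : f @^-1` Y = (\bigcup_k (D k `&` translate (t k) @^-1` Y)) `|`
    (~` (\bigcup_k D k) `&` Y)).
  apply: measurableU.
    apply: countable_bigcupT_measurable => // k; apply: measurableI => //.
    by rewrite -[X in measurable X]setTI; exact: measurable_translate.
  apply: measurableI => //; apply: measurableC.
  exact: countable_bigcupT_measurable.
apply/seteqP; split => x /=.
  move=> Yfx; have [[k Dk]|nD] := pselect (exists k, D k x).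
    by left; exists k => //; split => //=; rewrite -(fD _ _ Dk).
  right; split; first by move=> [k _ Dk]; apply: nD; exists k.
  by rewrite -(fN x)// => k Dk; apply: nD; exists k.
move=> [[k _ [Dk]]|[nD]]; first by rewrite /= -(fD _ _ Dk).
by rewrite fN// => k Dk; apply: nD; exists k.
Qed.

Lemma measurable_T : measurable_fun setT (T : RT -> RT).
Proof.
apply: (@measurable_fun_piecewise_translation _
  (fun nj => if (nj.2.+1 < H nj.1)%N then level nj.1 nj.2 else set0)
  (fun nj => lev nj.1 nj.2.+1 - lev nj.1 nj.2)).
- by move=> [n j] /=; case: ifP => // _; exact: measurable_level.
- move=> [n j] x /=; case: ifP => // jH xj.
  by rewrite (T_level jH xj) /translate; lra.
- move=> x nD; rewrite /Defs.T; case: pselect => // e; exfalso.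
  case: e => -[n j] [/= jH xj].
  by rewrite size_col in jH; have := nD (n, j); rewrite /= jH => /(_ xj).
Qed.

Lemma measurable_Tinv : measurable_fun setT (Tinv : RT -> RT).
Proof.
apply: (@measurable_fun_piecewise_translation _
  (fun nj => if (nj.2.+1 < H nj.1)%N then level nj.1 nj.2.+1 else set0)
  (fun nj => lev nj.1 nj.2 - lev nj.1 nj.2.+1)).
- by move=> [n j] /=; case: ifP => // _; exact: measurable_level.
- move=> [n j] x /=; case: ifP => // jH xj.
  by rewrite (Tinv_level jH xj) /translate; lra.
- move=> x nD; rewrite /Defs.Tinv; case: pselect => // e; exfalso.
  case: e => -[n [|j]] [//= _ [jH xj]].
  by rewrite size_col in jH; have := nD (n, j); rewrite /= jH => /(_ xj).
Qed.

Lemma measurable_iter e (U : measurableType e) (f : U -> U) k :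
  measurable_fun setT f -> measurable_fun setT (iter k f).
Proof.
move=> mf; elim: k => [|k IH]; first exact: measurable_id.
exact: (measurableT_comp mf IH).
Qed.

Lemma measurable_prod_iter (f g : RT -> RT) p q :
  measurable_fun setT f -> measurable_fun setT g ->
  measurable_fun setT (fun z : RR => (iter p f z.1, iter q g z.2) : RR).
Proof.
move=> mf mg; apply/measurable_fun_pairP; split.
- exact: (measurableT_comp (measurable_iter p mf) measurable_fst).
- exact: (measurableT_comp (measurable_iter q mg) measurable_snd).
Qed.

Lemma iter_prod_iter (U V : Type) (f : U -> U) (g : V -> V) p q t (z : U * V) :
  iter t (fun z => (iter p f z.1, iter q g z.2)) z =
  (iter (t * p) f z.1, iter (t * q) g z.2).
Proof.
by elim: t => [|t IH]; rewrite ?mul0n -?surjective_pairing// iterS IH/= -!iterD -!mulSn.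
Qed.

Definition hits (S : RR -> RR) := forall A B : set RR,
  measurable A -> measurable B -> A `<=` X `*` X -> B `<=` X `*` X ->
  (0 < mu2 A)%E -> (0 < mu2 B)%E ->
  exists2 t, (0 < t)%N & (0 < mu2 (iter t S @^-1` B `&` A))%E.

Lemma hits_conservative S : hits S -> conservative mu2 (X `*` X) S.
Proof.
by move=> hS A mA AX A0; have [t t0 h] := hS A A mA mA AX AX A0 A0; exists t.
Qed.

(** Invariance puts [A] inside its preimage under [S], so an orbit that starts in [A] never reaches
    the complement; [A] and its complement cannot both have positive measure. *)
Lemma hits_ergodic S : hits S -> ergodic mu2 (X `*` X) S.
Proof.
move=> hS A mA AX SA.
have mXA : measurable (X `*` X `\` A).
  by apply: measurableD => //; apply: measurableX; exact: measurable_rk_space.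
have [A0|A0] := eqVneq (mu2 A) 0%E; first by left.
have [B0|B0] := eqVneq (mu2 (X `*` X `\` A)) 0%E; first by right.
have [||t _] := hS A (X `*` X `\` A) mA mXA AX (@subDsetl _ _ _).
- by rewrite lt0e A0 measure_ge0.
- by rewrite lt0e B0 measure_ge0.
rewrite (_ : _ `&` A = set0) ?measure0 ?ltxx//.
rewrite -subset0 => z [/= [_ nA] Az]; apply: nA.
elim: t => [//|t IH]; rewrite iterS; move: IH; rewrite -{1}SA => -[_].
exact.
Qed.

(** * Return times and the hitting property of the two products *)

Section Hits.
Variables p q : nat.
Hypothesis pq_return : forall k l : nat,
  infinite_set [set n : nat | exists t : nat,
    (Defs.qq a b c d n + l = t * q)%N /\ (Defs.pp a b c d n + k = t * p)%N].

(** An infinite set of stages is not contained in [I_N], and [t = 0] would give [p_n + k = 0]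
    although [p_n >= H n > 0]. *)
Lemma return_time k l N : exists n t, [/\ (N <= n)%N, (0 < t)%N,
  (Defs.qq a b c d n + l = t * q)%N & (Defs.pp a b c d n + k = t * p)%N].
Proof.
apply: contrapT => nh; apply: (@pq_return k l).
apply: (@sub_finite_set _ _ `I_N); last exact: finite_II.
move=> n [t [hq hp]] /=; rewrite ltnNge; apply/negP => Nn; apply: nh.
exists n, t; split=> //; rewrite lt0n; apply/negP => /eqP t0.
have := Hgt_gt0 a b c d n; move: hp; rewrite t0 mul0n /Defs.pp; lia.
Qed.

(** [A] is taken in the bottom copy and [B] in the top one for both coordinates, so that both
    offsets are natural numbers. *)
Lemma hits_T_T : hits (fun z => (iter p T z.1, iter q T z.2)).
Proof.
move=> A B mA mB AX BX A0 B0.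
have [N [i [i' [j [j' [[iH i'H jH j'H] h]]]]]] :=
  @good_square_pair R a b c d A B 0 3 0 3 isT isT isT isT mA mB AX BX A0 B0.
(* The truncated subtractions are exact: [copy N 3 >= H N], which exceeds [i] and [j]. *)
pose k := (copy N 3 + i' - i)%N; pose l := (copy N 3 + j' - j)%N.
have kE : (i + k = copy N 3 + i')%N.
  by rewrite /k /= /Defs.pp; lia.
have lE : (j + l = copy N 3 + j')%N.
  by rewrite /l /= /Defs.pp; lia.
(* The offsets are fixed at stage [N.+1], before [n] is chosen; refinement up to stage [n] preserves
   them. *)
clearbody k l; have [n [t [Nn t0 hq hp]]] := return_time k l N.+1.
have := mass_pair_refine (measurableC mA) (measurableC mB) Nn
  (copy_lt _ iH) (copy_lt _ i'H)
  (copy_lt _ jH) (copy_lt _ j'H) h.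
move=> [I [I' [J [J' [[IH I'H JH J'H] eI eJ hIJ]]]]].
exists t => //.
apply: (@return_square R a b c d A B _ n I I' J J' 0 1 2 3) => //.
  by apply: measurable_iter; apply: measurable_prod_iter; exact: measurable_T.
move=> z [z1 z2]; rewrite iter_prod_iter -hp -hq; congr (_, _).
(* From [copy n 0 + I], a climb of [p_n + k] ends at [copy n 1 + I']. This is a level of the column
   of stage [n.+1], so the whole orbit segment stays in that column. *)
- rewrite (iter_T_level _ z1).
    congr (_ + lev _ _); move: eI kE; rewrite /copy; lia.
  have := copy_lt 1 I'H; move: eI kE; rewrite /copy; lia.
- rewrite (iter_T_level _ z2).
    congr (_ + lev _ _); move: eJ lE; rewrite /copy; lia.
  have := copy_lt 3 J'H; move: eJ lE; rewrite /copy; lia.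
Qed.

(** The inverse moves down, so in the first coordinate the roles are exchanged: [A] lies in the top
    copy, [B] in the bottom one, and at stage [n] the orbit descends from the second copy to the
    first. *)
Lemma hits_Tinv_T : hits (fun z => (iter p Tinv z.1, iter q T z.2)).
Proof.
move=> A B mA mB AX BX A0 B0.
have [N [i [i' [j [j' [[iH i'H jH j'H] h]]]]]] :=
  @good_square_pair R a b c d A B 3 0 0 3 isT isT isT isT mA mB AX BX A0 B0.
pose k := (copy N 3 + i - i')%N; pose l := (copy N 3 + j' - j)%N.
have kE : (i' + k = copy N 3 + i)%N.
  by rewrite /k /= /Defs.pp; lia.
have lE : (j + l = copy N 3 + j')%N.
  by rewrite /l /= /Defs.pp; lia.
clearbody k l; have [n [t [Nn t0 hq hp]]] := return_time k l N.+1.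
have := mass_pair_refine (measurableC mA) (measurableC mB) Nn
  (copy_lt _ iH) (copy_lt _ i'H)
  (copy_lt _ jH) (copy_lt _ j'H) h.
move=> [I [I' [J [J' [[IH I'H JH J'H] eI eJ hIJ]]]]].
exists t => //.
apply: (@return_square R a b c d A B _ n I I' J J' 1 0 2 3) => //.
  apply: measurable_iter; apply: measurable_prod_iter; last exact: measurable_T.
  exact: measurable_Tinv.
move=> z [z1 z2]; rewrite iter_prod_iter -hp -hq; congr (_, _).
(* The starting height is rewritten as the target height plus the number of steps, the form in which
   [iter_Tinv_level] describes a descent. *)
- have e : (copy n 1 + I = copy n 0 + I' + (Defs.pp a b c d n + k))%N.
    by move: eI kE; rewrite /copy; lia.
  move: z1; rewrite e => z1; rewrite (iter_Tinv_level _ z1)//.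
  by rewrite -e copy_lt.
- rewrite (iter_T_level _ z2).
    congr (_ + lev _ _); move: eJ lE; rewrite /copy; lia.
  have := copy_lt 3 J'H; move: eJ lE; rewrite /copy; lia.
Qed.

End Hits.
End Powers.

Theorem mainTheorem1 (R : realType) (a b c d : nat -> nat) (p q : nat) :
  (forall n, [/\ (0 < a n)%N, (0 < b n)%N, (0 < c n)%N & (0 < d n)%N]) ->
  @inW R a b c d ->
  (0 < p)%N -> (0 < q)%N ->
  (forall k l : nat,
      infinite_set [set n : nat | exists t : nat,
        (@qq a b c d n + l = t * q)%N /\ (@pp a b c d n + k = t * p)%N]) ->
  let mu := ((@lebesgue_measure R) \x (@lebesgue_measure R))%E in
  let XX := @rk_space R a b c d `*` @rk_space R a b c d in
  let Tp := fun z : R * R => (iter p (@T R a b c d) z.1, iter q (@T R a b c d) z.2) in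
  let Tmp := fun z : R * R => (iter p (@Tinv R a b c d) z.1, iter q (@T R a b c d) z.2) in
  [/\ conservative mu XX Tp, ergodic mu XX Tp,
      conservative mu XX Tmp & ergodic mu XX Tmp].
Proof.
move=> _ _ _ _ pq mu XX Tp Tmp.
have hp := @hits_T_T R _ _ _ _ _ _ pq.
have hm := @hits_Tinv_T R _ _ _ _ _ _ pq.
split; [exact: hits_conservative|exact: hits_ergodic|
        exact: hits_conservative|exact: hits_ergodic].
Qed.
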